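(* For all integers $n\geq m\geq 2$, $$Q_{m-1}(x,y,z,t)Q_{n+1}(x,y,z,t)-Q_m(x,y,z,t)Q_n(x,y,z,t)\in\mathbb N[x,y,z,t],$$ i.e. the sequence $\{Q_n(x,y,z,t)\}_{n\geq 1}$ is strongly $\{x,y,z,t\}$-log-convex.
   Context: The generalized Ramanujan polynomials $Q_n(x,y,z,t)$ are defined by $Q_1=1$ and, for $n\geq1$, $Q_{n+1}=(x+nz)Q_n+(y+t)\left(nQ_n+y\,\frac{\partial Q_n}{\partial y}\right)$. For instance $Q_2=x+y+z+t$. *)

(* Defs.v *)
From HB Require Import structures.
From mathcomp Require Import all_boot all_order all_algebra.
From mathcomp Require Import mpoly.

Set Implicit Arguments.
Unset Strict Implicit.
Unset Printing Implicit Defensive.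

Import GRing.Theory Num.Theory.
Local Open Scope ring_scope.

Definition iy : 'I_4 := inord 1.
Definition x_ : {mpoly int[4]} := 'X_(inord 0).
Definition y_ : {mpoly int[4]} := 'X_iy.
Definition z_ : {mpoly int[4]} := 'X_(inord 2).
Definition t_ : {mpoly int[4]} := 'X_(inord 3).

(* The sequence starts at index 1; the value at index 0 is a dummy. *)
Fixpoint ramQ (n : nat) : {mpoly int[4]} :=
  match n with
  | 0 => 0
  | 1 => 1
  | k.+1 => (x_ + k%:R * z_) * ramQ k
            + (y_ + t_) * (k%:R * ramQ k + y_ * mderiv iy (ramQ k))
  end.

(* Main.v *)
(** Write [Q_n] as a sum of [c n k * y ^ k].  The recurrence gives
      c (n+1) k = (x + n z + (n + k) t) c n k + (n + k - 1) c n (k - 1),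
    and, by induction along it, [c p i * c q j - c p k * c q l] has natural
    coefficients whenever [p <= q], [i + j = k + l] and [i, j <= k].
    For [p = q] this is log-concavity of the rows.  Finally
      Q_p Q_(q+1) - Q_(p+1) Q_q
        = (q - p) (y + z + t) Q_p Q_q + (y + t) y (Q_p Q_q' - Q_p' Q_q),
    and pairing the terms [(i, j)] and [(j, i)] of the Wronskian exhibits it as
    a combination of the differences above, with weights [j - i > 0]. *)

Require Import Defs.
From mathcomp Require Import all_boot all_order all_algebra.
From mathcomp Require Import mpoly.
From mathcomp Require Import zify ring.

Import GRing.Theory.

Local Open Scope ring_scope.

(** * Domination between rows of coefficients *)

Section RowCoefficients.

Variables (R : comNzRingType) (S : semiringClosed R) (x z t : R).
Hypotheses (Sx : x \in S) (Sz : z \in S) (St : t \in S).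

Definition stay (n k : nat) : R := x + n.+1%:R * z + (n.+1 + k)%:R * t.

(* [coef n k.+1] is the coefficient of [y ^ k] in [Q_(n+1)]; the shift leaves
   room for the vanishing coefficient of index [-1]. *)
Fixpoint coef (n k : nat) : R :=
  match n, k with
  | _, 0 => 0
  | 0, k'.+1 => (k' == 0)%N%:R
  | n'.+1, k'.+1 => stay n' k' * coef n' k'.+1 + (n' + k')%:R * coef n' k'
  end.

Lemma coefn0 n : coef n 0 = 0.
Proof. by case: n. Qed.

Lemma coefSS n k :
  coef n.+1 k.+1 = stay n k * coef n k.+1 + (n + k)%:R * coef n k.
Proof. by []. Qed.

Lemma coef_gt n k : (n.+1 < k)%N -> coef n k = 0.
Proof.
elim: n k => [|n IHn] [|k] //; first by case: k.
by rewrite ltnS => nk; rewrite coefSS !IHn ?mulr0 ?addr0 // ltnW.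
Qed.

Lemma stay_closed n k : stay n k \in S.
Proof. by rewrite /stay !rpredD ?rpredM ?rpred_nat. Qed.

Lemma coef_closed n k : coef n k \in S.
Proof.
elim: n k => [|n IHn] [|k]; rewrite /= ?rpred0 ?rpred_nat //.
by rewrite rpredD ?rpredM ?rpred_nat ?stay_closed.
Qed.

(** The equal sums also force [l <= i] and [l <= j], so [(k, l)] is the more spread pair; its larger
    index falls on [a], the earlier row. *)
Definition dominates (a b : nat -> R) := forall i j k l,
  (i + j = k + l)%N -> (i <= k)%N -> (j <= k)%N -> a i * b j - a k * b l \in S.

(* With [X1 >= X2 >= Y1 >= Y2] only partial sums of the weights matter, so it
   suffices that [u1 + u2] dominates [v1 + v2]. *)
Lemma chain_closed (u1 u2 v1 v2 d X1 X2 Y1 Y2 : R) :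
  u1 \in S -> u2 \in S -> v2 \in S -> d \in S -> Y2 \in S ->
  X1 - X2 \in S -> X2 - Y1 \in S -> Y1 - Y2 \in S -> u1 + u2 = v1 + v2 + d ->
  u1 * X1 + u2 * X2 - (v1 * Y1 + v2 * Y2) \in S.
Proof.
move=> Su1 Su2 Sv2 Sd SY2 S12 S2 SY e.
have {e}-> : v1 = u1 + u2 - v2 - d by rewrite e; ring.
have -> : u1 * X1 + u2 * X2 - ((u1 + u2 - v2 - d) * Y1 + v2 * Y2) =
  u1 * (X1 - X2) + (u1 + u2) * (X2 - Y1) + (v2 + d) * (Y1 - Y2) + d * Y2.
  by ring.
by rewrite !rpredD ?rpredM // ?rpredD.
Qed.

Lemma scaled_closed (u v d X Y : R) :
  v \in S -> d \in S -> X \in S -> X - Y \in S -> u = v + d ->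
  u * X - v * Y \in S.
Proof.
move=> Sv Sd SX SXY ->.
have -> : (v + d) * X - v * Y = v * (X - Y) + d * X by ring.
by rewrite rpredD ?rpredM.
Qed.

(** Expanding by the recurrence gives three groups: both factors keep their index, both lower it, or
    exactly one does. In each group the total weight exceeds its counterpart by a multiple of
    [i * j - k * l], which is positive for an inner pair with the same sum. *)
Lemma coef_row_step_ordered n i j k l :
  dominates (coef n) (coef n) ->
  (i + j = k + l)%N -> (l < i)%N -> (i <= j)%N -> (j < k)%N ->
  coef n.+1 i.+1 * coef n.+1 j.+1 - coef n.+1 k.+1 * coef n.+1 l.+1 \in S.
Proof.
move=> dom e li ij jk.
have [w E] : exists w, (i * j = k * l + w)%N by exists (i * j - k * l)%N; nia.
have ew : w%:R = i%:R * j%:R - k%:R * l%:R :> R.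
  by rewrite -!natrM E natrD; ring.
have ei : i%:R = k%:R + l%:R - j%:R :> R by rewrite -natrD -e natrD; ring.
rewrite !coefSS.
have -> : forall A B A' B' C D C' D' a b a' b' c d c' d' : R,
  (A * a + B * b) * (A' * a' + B' * b') - (C * c + D * d) * (C' * c' + D' * d')
  = (A * A' * (a * a') - C * C' * (c * c'))
    + (B * B' * (b * b') - D * D' * (d * d'))
    + (A * B' * (a * b') + B * A' * (b * a')
       - (D * C' * (d * c') + C * D' * (c * d'))).
  by move=> *; ring.
apply: rpredD; first apply: rpredD.
- apply: (@scaled_closed _ _ (w%:R * t ^+ 2));
    rewrite ?rpredM ?rpred_nat ?stay_closed ?coef_closed //.
    by apply: dom; lia.
  by rewrite /stay !natrD ew ei; ring.
- apply: (@scaled_closed _ _ w%:R); rewrite ?rpredM ?rpred_nat ?coef_closed //.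
    by apply: dom; lia.
  by rewrite !natrD ew ei; ring.
(* The index pairs [(i+1, j)], [(i, j+1)], [(k, l+1)], [(k+1, l)] are increasingly spread, so the
   four products descend; [j < k] gives the middle comparison. *)
- apply: (@chain_closed _ _ _ _ (2%:R * w%:R * t));
    rewrite ?rpredM ?rpred_nat ?stay_closed ?coef_closed //.
  + by rewrite [X in _ - X]mulrC; apply: dom; lia.
  + by apply: dom; lia.
  + by apply: dom; lia.
  by rewrite /stay !natrD ew ei; ring.
Qed.

Lemma coef_row_step n :
  dominates (coef n) (coef n) -> dominates (coef n.+1) (coef n.+1).
Proof.
move=> dom.
suff main i j k l : (i + j = k + l)%N -> (i <= j)%N -> (j <= k)%N ->
    coef n.+1 i * coef n.+1 j - coef n.+1 k * coef n.+1 l \in S.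
  move=> i j k l e ik jk; case: (leqP i j) => [ij|/ltnW ji]; first exact: main.
  by rewrite mulrC; apply: main => //; rewrite addnC.
case: l => [|l] e ij jk.
  by rewrite coefn0 mulr0 subr0 rpredM ?coef_closed.
case: (eqVneq j k) => [ejk|njk].
  by rewrite (_ : i = l.+1) ?ejk 1?mulrC ?subrr ?rpred0 //; lia.
case: i j k e ij jk njk => [|i] [|j] [|k] e ij jk njk; try by lia.
by apply: coef_row_step_ordered => //; lia.
Qed.

Lemma coef_row_dominates n : dominates (coef n) (coef n).
Proof.
elim: n => [|n IHn]; last exact: coef_row_step.
(* The first row lives at index 1 alone, so the subtracted product survives only for [k = l = 1],
   which forces [i = j = 1]. *)
case=> [|[|i]] [|[|j]] [|[|k]] [|[|l]] //= e ik jk;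
  rewrite ?(mul0r, mulr0, mulr1, subr0, subrr, rpred0, rpred1) //; lia.
Qed.

(** Only the second row advances. Since [i <= k] gives [l <= j], both weights at [j] exceed those at
    [l], and the two terms of the recurrence compare separately. *)
Lemma coef_dominates p q : (p <= q)%N -> dominates (coef p) (coef q).
Proof.
move=> /subnK <-; elim: (q - p)%N => [|d IHd]; first exact: coef_row_dominates.
rewrite addSn; move: (d + p)%N IHd => {}q dom i j k [|l] e ik jk.
  by rewrite coefn0 mulr0 subr0 rpredM ?coef_closed.
case: j e jk => [|j] e jk; first by lia.
rewrite !coefSS.
have -> : forall A B C D a b c d e' f : R,
  e' * (A * a + B * b) - f * (C * c + D * d)
  = (A * (e' * a) - C * (f * c)) + (B * (e' * b) - D * (f * d)).
  by move=> *; ring.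
apply: rpredD.
- apply: (@scaled_closed _ _ ((j - l)%:R * t));
    rewrite ?rpredM ?rpred_nat ?stay_closed ?coef_closed //.
    by apply: dom; lia.
  rewrite (_ : j = j - l + l)%N; last by lia.
  by rewrite addnK /stay !natrD; ring.
- apply: (@scaled_closed _ _ (j - l)%:R);
    rewrite ?rpredM ?rpred_nat ?coef_closed //.
    by apply: dom; lia.
  by rewrite -natrD; congr _%:R; lia.
Qed.

(** * From coefficients to polynomials in [y] *)

Variables (y : R) (Sy : y \in S).

(** A bound [N] shared by all rows makes their products square double sums. *)
Definition row_poly (N n : nat) : R := \sum_(k < N) coef n k.+1 * y ^+ k.

Definition row_euler (N n : nat) : R :=
  \sum_(k < N) k%:R * (coef n k.+1 * y ^+ k).

Lemma row_poly_closed N n : row_poly N n \in S.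
Proof. by apply: rpred_sum => k _; rewrite rpredM ?rpredX ?coef_closed. Qed.

Lemma row_polyS N n : (n.+1 < N)%N ->
  row_poly N n.+1 = (x + n.+1%:R * z) * row_poly N n
    + (y + t) * (n.+1%:R * row_poly N n + row_euler N n).
Proof.
case: N => // N nN.
have -> : n.+1%:R * row_poly N.+1 n + row_euler N.+1 n
    = \sum_(k < N.+1) (n.+1 + k)%:R * (coef n k.+1 * y ^+ k).
  rewrite mulr_sumr -big_split; apply: eq_bigr => k _.
  by rewrite /= natrD mulrDl.
rewrite (mulrDl y) addrA addrAC {1}/row_poly.
under eq_bigr => k _ do rewrite coefSS mulrDl.
rewrite big_split !mulr_sumr; congr (_ + _).
  by rewrite -big_split; apply: eq_bigr => k _; rewrite /stay /=; ring.
(* Multiplication by [y] shifts the index by one: the bottom term vanishes by [coefn0], the top one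
   because [n.+1 < N]. *)
rewrite big_ord_recl coefn0 mulr0 mul0r [LHS]add0r.
rewrite [RHS]big_ord_recr /= coef_gt ?ltnS // !(mul0r, mulr0, addr0).
by apply: eq_bigr => k _; rewrite /bump add1n exprS addnS -addSn; ring.
Qed.

(** Enlarging the square adds a corner, a row and a column; the last two pair up across the
    diagonal. *)
Lemma square_sum_closed (G : nat -> nat -> R) :
  (forall i, G i i \in S) -> (forall i j, (i < j)%N -> G i j + G j i \in S) ->
  forall N, \sum_(i < N) \sum_(j < N) G i j \in S.
Proof.
move=> Gd Gs; elim=> [|N IHN]; first by rewrite big_ord0 rpred0.
rewrite big_ord_recr /=; under eq_bigr => i _ do rewrite big_ord_recr /=.
rewrite big_split /= [X in _ + _ + X]big_ord_recr /= addrA -(addrA (bigop _ _ _)).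
by rewrite -big_split /= rpredD ?rpredD // rpred_sum // => i _; apply: Gs.
Qed.

Lemma wronskian_closed N p q : (p <= q)%N ->
  row_poly N p * row_euler N q - row_euler N p * row_poly N q \in S.
Proof.
move=> pq; rewrite /row_poly /row_euler !big_distrlr /= -sumrB.
under eq_bigr => i _ do rewrite -sumrB.
pose G i j : R := coef p i.+1 * y ^+ i * (j%:R * (coef q j.+1 * y ^+ j))
  - i%:R * (coef p i.+1 * y ^+ i) * (coef q j.+1 * y ^+ j).
apply: (square_sum_closed G) => [i|i j ij].
  by rewrite /G mulrCA mulrA subrr rpred0.
have -> : G i j + G j i = (j - i)%:R * y ^+ (i + j)
    * (coef p i.+1 * coef q j.+1 - coef p j.+1 * coef q i.+1).
  by rewrite /G natrB 1?ltnW // exprD; ring.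
rewrite !rpredM ?rpred_nat ?rpredX //.
by apply: coef_dominates => //; lia.
Qed.

Lemma row_poly_strong_log_convex N p q : (p <= q)%N -> (q.+1 < N)%N ->
  row_poly N p * row_poly N q.+1 - row_poly N p.+1 * row_poly N q \in S.
Proof.
move=> pq qN; rewrite !row_polyS //; last by lia.
set P := row_poly N p; set Q := row_poly N q.
set P' := row_euler N p; set Q' := row_euler N q.
rewrite [X in X \in S](_ : _ = (q - p)%:R * (y + z + t) * (P * Q)
    + (y + t) * (P * Q' - P' * Q)).
  apply: rpredD; apply: rpredM; last exact: wronskian_closed.
  - by rewrite rpredM ?rpredD ?rpred_nat.
  - by rewrite rpredM ?row_poly_closed.
  - by rewrite rpredD.
by rewrite natrB //; ring.
Qed.

End RowCoefficients.

(** * Identification with [ramQ] *)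

Notation rcoef := (coef {mpoly int[4]} x_ z_ t_).

Lemma mderiv_var (i j : 'I_4) :
  mderiv i ('X_j : {mpoly int[4]}) = (i == j)%:R.
Proof.
rewrite mderivX mnmE eq_sym; case: eqP => [->|_]; last by rewrite scale0r.
by rewrite scale1r -{1}[U_(j)%MM]add0m addmK mpolyX0.
Qed.

Lemma mderiv_nat (i : 'I_4) k : mderiv i (k%:R : {mpoly int[4]}) = 0.
Proof. by rewrite mderivMn -mpolyC1 mderivC mul0rn. Qed.

Lemma mderiv_coef n k : mderiv iy (rcoef n k) = 0.
Proof.
have [dx dz dt] : [/\ mderiv iy x_ = 0, mderiv iy z_ = 0 & mderiv iy t_ = 0].
  by split; rewrite mderiv_var /iy -val_eqE /= !inordK.
elim: n k => [|n IHn] [|k]; rewrite ?coefn0 ?mderiv0 //=; first exact: mderiv_nat.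
rewrite /stay !(mderivD, mderivM, mderiv_nat) !IHn dx dz dt.
by rewrite !(mulr0, mul0r, addr0).
Qed.

Lemma euler_var k : y_ * mderiv iy (y_ ^+ k) = k%:R * y_ ^+ k.
Proof.
elim: k => [|k IHk]; first by rewrite expr0 (mderiv_nat iy 1) mulr0 mul0r.
by rewrite exprS mderivM mderiv_var eqxx mul1r IHk -natr1; ring.
Qed.

Lemma ramQ_row_poly N n : (n < N)%N ->
  ramQ n.+1 = row_poly {mpoly int[4]} x_ z_ t_ y_ N n.
Proof.
elim: n => [|n IHn] nN.
  case: N nN => // N _; rewrite /row_poly big_ord_recl /= mulr1 big1 ?addr0 //.
  by move=> k _; rewrite mul0r.
rewrite row_polyS // -IHn ?(ltnW nN) //.
(* Once this holds, the goal is the defining recurrence of [ramQ] by computation. *)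
suff -> : row_euler _ x_ z_ t_ y_ N n = y_ * mderiv iy (ramQ n.+1) by [].
rewrite IHn ?(ltnW nN) // /row_poly raddf_sum big_distrr /=.
apply: eq_bigr => k _.
by rewrite mderivM mderiv_coef mul0r add0r mulrCA -euler_var mulrCA.
Qed.

Definition nat_coefs : semiringClosed int :=
  GRing.SemiringClosed.clone int (@Num.nat_num_subdef int) _.

Definition nat_mpolys : semiringClosed {mpoly int[4]} :=
  GRing.SemiringClosed.clone {mpoly int[4]} (@mpolyOver_pred 4 int nat_coefs) _.

Theorem theorem1p5 (m n : nat) (hm : (2 <= m)%N) (hmn : (m <= n)%N) :
  ramQ m.-1 * ramQ n.+1 - ramQ m * ramQ n \is a mpolyOver 4 (R := int) Num.nat.
Proof.
case: m n hm hmn => [|[|p]] // [|q] // _ pq.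
(* Row [n] is [ramQ n.+1], so the last row met is [q.+1], and [q.+2] is the least bound that
   fits. *)
rewrite ![ramQ _](ramQ_row_poly q.+2); try by lia.
by apply: (row_poly_strong_log_convex _ nat_mpolys);
  rewrite ?(mpolyOverX nat_coefs) //; lia.
Qed.
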